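(* Let $p = 2j/(2j-1)$ for some integer $j>1$, and let $H$ be a $p$-conjugate of a function $f$ in $L^p$. Then the minimal majorant of $f$ in $L^p$ is $(\overline H)^{j-1}H^j$, and $H$ is the only $p$-conjugate of $f$.
   Context: $L^p$ denotes the space of complex-valued ($2\pi$-periodic) functions on $[-\pi,\pi)$ with norm $\|f\|_p = \left(\frac{1}{2\pi}\int_{-\pi}^{\pi}|f(\theta)|^p\,d\theta\right)^{1/p}$, and $\hat f(n) = \frac{1}{2\pi}\int_{-\pi}^\pi f(\theta)e^{-in\theta}\,d\theta$ for integers $n$. A function $F$ is a majorant of $f$ when $|\hat f(n)| \le \hat F(n)$ for all integers $n$; the minimal majorant of $f$ in $L^p$ is the unique majorant of $f$ in $L^p$ of least $L^p$ norm (unique by uniform convexity when a majorant in $L^p$ exists). For $p=2j/(2j-1)$ with $j>1$ an integer, and $f\in L^p$, a function $H \in L^{2j}$ is a $p$-conjugate of $f$ if: (1) $\hat H(n) \ge 0$ for all $n$; (2) the product $J = (\overline H)^{j-1}H^j$ majorizes $f$; (3) $\hat H(n) = 0$ at all integers $n$ where $\hat J(n) > |\hat f(n)|$; (4) $\hat H(n) = 0$ for all $n$ off the support of $\hat f$ (i.e. whenever $\hat f(n)=0$). *)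

(* Defs.v *)
From HB Require Import structures.
From mathcomp Require Import all_boot all_order all_algebra.
From mathcomp Require Import complex.
From mathcomp Require Import all_classical all_reals all_analysis.

Set Implicit Arguments.
Unset Strict Implicit.
Unset Printing Implicit Defensive.

Import Order.TTheory GRing.Theory Num.Theory.
Import numFieldNormedType.Exports.

Local Open Scope classical_set_scope.
Local Open Scope ring_scope.
Local Open Scope complex_scope.

(* A 2 pi-periodic function is represented by any function R -> R[i]; only its
   values on [-pi, pi[ are ever used. Elements of L^p are compared almost
   everywhere on [-pi, pi[ (ae_eq_circle), never by Leibniz equality, and
   measurability is Borel: every class of Lebesgue measurable functions modulo
   null sets has a Borel representative. *)
Definition circle (R : realType) : set R := `[- pi, pi[%classic.
Arguments circle : clear implicits.

Definition cmod (R : realType) (z : R[i]) : R := ComplexField.Normc.normc z.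

Definition cmeasurable (R : realType) (D : set R) (f : R -> R[i]) : Prop :=
  measurable_fun D (fun t => complex.Re (f t)) /\
  measurable_fun D (fun t => complex.Im (f t)).

(* Meaningful when Re f and Im f are integrable on D. *)
Definition cintegral (R : realType) (D : set R) (f : R -> R[i]) : R[i] :=
  (\int[lebesgue_measure]_(t in D) complex.Re (f t)) +i*
  (\int[lebesgue_measure]_(t in D) complex.Im (f t)).

Definition expi (R : realType) (t : R) : R[i] := cos t +i* sin t.

Definition ae_eq_circle (R : realType) (f g : R -> R[i]) : Prop :=
  {ae lebesgue_measure, forall t : R, circle R t -> f t = g t}.

Definition in_Lp (R : realType) (p : R) (f : R -> R[i]) : Prop :=
  cmeasurable (circle R) f /\
  lebesgue_measure.-integrable (circle R) (EFin \o (fun t => cmod (f t) `^ p)).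

Definition Lp_norm (R : realType) (p : R) (f : R -> R[i]) : R :=
  ((2 * pi)^-1 * \int[lebesgue_measure]_(t in circle R) (cmod (f t) `^ p))
    `^ p^-1.

Definition fourier (R : realType) (f : R -> R[i]) (n : int) : R[i] :=
  ((2 * pi)^-1)%:C * cintegral (circle R) (fun t => f t * expi (- (n%:~R * t))).

(* The orders below are those of R[i]: z <= w holds iff w - z is a nonnegative
   real. In particular the Fourier coefficients of a majorant are nonnegative
   reals. *)
Definition majorant (R : realType) (f F : R -> R[i]) : Prop :=
  forall n : int, `|fourier f n| <= fourier F n.

Definition minimal_majorant (R : realType) (p : R) (f F : R -> R[i]) : Prop :=
  [/\ in_Lp p F,
      majorant f F,
      (forall G : R -> R[i], in_Lp p G -> majorant f G ->
         Lp_norm p F <= Lp_norm p G) &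
      (forall G : R -> R[i], in_Lp p G -> majorant f G ->
         Lp_norm p G = Lp_norm p F -> ae_eq_circle G F)].

Definition conj_product (R : realType) (j : nat) (H : R -> R[i]) : R -> R[i] :=
  fun t => (H t)^* ^+ j.-1 * H t ^+ j.

(* The exponent p = 2j / (2j - 1) enters only through j. *)
Definition p_conjugate (R : realType) (j : nat) (f H : R -> R[i]) : Prop :=
  let J := conj_product j H in
  in_Lp (2 * j)%:R H /\
  [/\ forall n : int, 0 <= fourier H n,
      majorant f J,
      forall n : int, `|fourier f n| < fourier J n -> fourier H n = 0 &
      forall n : int, fourier f n = 0 -> fourier H n = 0].

(* Main.v *)
Require Import Defs.
From HB Require Import structures.
From mathcomp Require Import all_boot all_order all_algebra.
From mathcomp Require Import complex.
From mathcomp Require Import all_classical all_reals all_analysis.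
From mathcomp Require Import measurable_realfun.
From mathcomp Require Import ring lra.

(** Put m = 2j - 1, so that p = (m + 1) / m, and J = conj(H)^(j-1) H^j. Then
    |J| = |H|^m and J conj(H) = |H|^(m+1), hence |J|^p = |H|^(m+1).

    Let G be any majorant of f in L^p. At a frequency n with hat H(n) <> 0 the
    third condition on H forces hat J(n) = |hat f(n)| <= hat G(n), so that
    (hat G(n) - hat J(n)) hat H(n) >= 0 for every n. By Parseval
    Re (int G conj(H)) >= int J conj(H) = int |H|^(m+1)
    ([conjugate_pairing_le]). Writing |G| = c^m, Young's inequality gives
    pointwise (m + 1) Re (G conj(H)) <= m c^(m+1) + |H|^(m+1) ([duality_le]),
    and integration yields int |J|^p = int |H|^(m+1) <= int c^(m+1) =
    int |G|^p: J has least norm. If the norms agree, Young's inequality is an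
    equality almost everywhere, which forces c = |H| and G conj(H) >= 0, that
    is G = J ([duality_eq]). Since z |-> conj(z)^(j-1) z^j is injective
    ([conj_product_inj]), H is determined almost everywhere by the minimal
    majorant J, whence the uniqueness of the p-conjugate.

    The analytic point is Parseval between L^p and L^(m+1), where the Fourier
    series need not converge. Only an inequality between two pairings is
    required, and it survives Fejer summation: the sums with weights
    1 - |n| / (N + 1) compare term by term ([cpairing_le]) and converge to the
    integrals ([cpairing_cvg]). The convergence is proved for real functions
    ([pairing_cvg]). The Fejer sum is the double integral of
    u(t) v(s) K_N(t - s) with a nonnegative kernel K_N of constant mass, so a
    bound |u(t)| |v(s)| <= A(t) + B(s) controls it uniformly in N
    ([pairing_bound]). This reduces the limit to u bounded and v continuous,
    by truncating u and approximating v in L^1; there the means converge at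
    every interior point ([fejer_cvg]) and dominated convergence applies. *)

Set Implicit Arguments.
Unset Strict Implicit.
Unset Printing Implicit Defensive.

Import Order.TTheory GRing.Theory Num.Theory.
Import numFieldNormedType.Exports.

Local Open Scope classical_set_scope.
Local Open Scope ring_scope.

(** * Integrals over the circle *)

Section circle_integral.
Context {R : realType}.
Local Notation cmfun := (measurable_fun (circle R : set (measurableTypeR R))).
Implicit Types (u v f g h : R -> R) (t s x : R).

Definition L1 f := lebesgue_measure.-integrable (circle R) (EFin \o f).
Definition circle_int f : R := \int[lebesgue_measure]_(t in circle R) f t.

Lemma measurable_circle : measurable (circle R : set (measurableTypeR R)).
Proof. exact: measurable_itv. Qed.

Lemma pi2_gt0 : 0 < 2 * pi :> R.
Proof. by rewrite mulr_gt0// pi_gt0. Qed.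

Lemma circle_measure : lebesgue_measure (circle R) = (2 * pi)%:E.
Proof.
rewrite /circle lebesgue_measure_itv/= lte_fin ifT.
  by rewrite -EFinB; congr EFin; ring.
by have := pi_gt0 R; lra.
Qed.

Lemma L1_measurable f : L1 f -> cmfun f.
Proof. by move=> /integrableP[/measurable_EFinP]. Qed.

Lemma L1D f g : L1 f -> L1 g -> L1 (fun t => f t + g t).
Proof. by move=> If Ig; rewrite /L1; exact: (integrableD measurable_circle If Ig). Qed.

Lemma L1Z a f : L1 f -> L1 (fun t => a * f t).
Proof. by move=> If; rewrite /L1; exact: (integrableZl measurable_circle a If). Qed.

Lemma L1B f g : L1 f -> L1 g -> L1 (fun t => f t - g t).
Proof. by move=> If Ig; rewrite /L1; exact: (integrableB measurable_circle If Ig). Qed.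

Lemma L1_sum (I : Type) (r : seq I) (F : I -> R -> R) :
  (forall i, L1 (F i)) -> L1 (fun t => \sum_(i <- r) F i t).
Proof.
move=> IF; elim: r => [|i r IHr].
  rewrite [X in L1 X](_ : _ = cst 0); first exact: integrable0.
  by apply/funext => t; rewrite big_nil.
rewrite [X in L1 X](_ : _ = fun t => F i t + \sum_(i <- r) F i t); first exact: L1D.
by apply/funext => t; rewrite big_cons.
Qed.

Lemma L1_le f g : cmfun f ->
  (forall t, circle R t -> `|f t| <= g t) -> L1 g -> L1 f.
Proof.
move=> mf fg Ig; apply: (le_integrable measurable_circle _ _ Ig).
  exact/measurable_EFinP.
by move=> t It /=; rewrite lee_fin (le_trans (fg _ It))// ler_norm.
Qed.

Lemma L1_norm f : L1 f -> L1 (fun t => `|f t|).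
Proof. by move=> If; exact: (integrable_norm If). Qed.

Lemma L1_cst a : L1 (cst a).
Proof.
rewrite /L1; apply: measurable_bounded_integrable => //.
- exact: measurable_circle.
- by rewrite [X in (X < _)%E](_ : _ = (2 * pi)%:E) ?ltry//; exact: circle_measure.
- by exists `|a|; split; [exact: num_real|move=> M aM x _; exact: ltW].
Qed.

Lemma L1_bounded f M : cmfun f ->
  (forall t, circle R t -> `|f t| <= M) -> L1 f.
Proof. by move=> mf fM; apply: (L1_le mf fM); exact: L1_cst. Qed.

Lemma L1Mbounded f g M : L1 f -> cmfun g ->
  (forall t, circle R t -> `|g t| <= M) -> L1 (fun t => f t * g t).
Proof.
move=> If mg gM; apply: (L1_le _ _ (L1Z M (L1_norm If))).
  by apply: measurable_funM => //; exact: L1_measurable.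
by move=> t It; rewrite normrM mulrC ler_wpM2r// gM.
Qed.

Lemma circle_intD f g : L1 f -> L1 g ->
  circle_int (fun t => f t + g t) = circle_int f + circle_int g.
Proof. by move=> If Ig; rewrite /circle_int RintegralD//; exact: measurable_circle. Qed.

Lemma circle_intB f g : L1 f -> L1 g ->
  circle_int (fun t => f t - g t) = circle_int f - circle_int g.
Proof. by move=> If Ig; rewrite /circle_int RintegralB//; exact: measurable_circle. Qed.

Lemma circle_intZ a f : L1 f -> circle_int (fun t => a * f t) = a * circle_int f.
Proof. by move=> If; rewrite /circle_int RintegralZl//; exact: measurable_circle. Qed.

Lemma circle_int_sum (I : Type) (r : seq I) (F : I -> R -> R) :
  (forall i, L1 (F i)) ->
  circle_int (fun t => \sum_(i <- r) F i t) = \sum_(i <- r) circle_int (F i).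
Proof.
move=> IF; elim: r => [|i r IHr].
  rewrite big_nil -[RHS](Rintegral_set0 lebesgue_measure (cst 0)).
  rewrite Rintegral_set0 /circle_int -[RHS](mul0r (fine (lebesgue_measure (circle R)))).
  rewrite -Rintegral_cst; last exact: measurable_circle.
  by apply: eq_Rintegral => t _; rewrite big_nil.
rewrite big_cons -IHr -circle_intD//; last exact: L1_sum.
by apply: eq_Rintegral => t _; rewrite big_cons.
Qed.

Lemma eq_circle_int f g :
  (forall t, circle R t -> f t = g t) ->
  circle_int f = circle_int g.
Proof. by move=> fg; apply: eq_Rintegral => t; rewrite inE => /fg. Qed.

Lemma circle_int_cst a : circle_int (cst a) = a * (2 * pi).
Proof.
rewrite /circle_int Rintegral_cst; last exact: measurable_circle.
by rewrite (_ : _ (circle R) = (2 * pi)%:E)//; exact: circle_measure.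
Qed.

Lemma circle_int_ge0 f : (forall t, circle R t -> 0 <= f t) -> 0 <= circle_int f.
Proof. by move=> f0; rewrite /circle_int; apply: Rintegral_ge0. Qed.

Lemma le_circle_int f g : L1 f -> L1 g ->
  (forall t, circle R t -> f t <= g t) -> circle_int f <= circle_int g.
Proof. by move=> *; apply: le_Rintegral => //; exact: measurable_circle. Qed.

Lemma le_norm_circle_int f g : cmfun f -> L1 g ->
  (forall t, circle R t -> `|f t| <= g t) -> `|circle_int f| <= circle_int g.
Proof.
move=> mf Ig fg; have If := L1_le mf fg Ig.
apply: (le_trans (le_normr_Rintegral measurable_circle If)).
by apply: le_circle_int => //; exact: L1_norm.
Qed.

Lemma continuous_measurable_circle f : continuous f -> cmfun f.
Proof.
move=> cf; apply: (@measurable_funS _ _ (measurableTypeR R) R setT) => //.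
exact: continuous_measurable_fun.
Qed.

End circle_integral.

(** * The Fejer kernel *)

Section fejer_kernel.
Context {R : realType}.
Implicit Types (u v f g h : R -> R) (t s x : R).

Definition cosn (n : int) t : R := cos (n%:~R * t).
Definition sinn (n : int) t : R := sin (n%:~R * t).
(** The pairs (k, l) with k - l = n number N + 1 - |n|: summing over pairs
    produces the Fejer weights without writing them. *)
Definition freq N (kl : 'I_N.+1 * 'I_N.+1) : int := (kl.1 : nat)%:Z - (kl.2 : nat)%:Z.

(** (N + 1)^-1 |1 + e^(ix) + .. + e^(iNx)|^2, a form in which positivity is
    visible. *)
Definition fejer N x : R := N.+1%:R^-1 *
  ((\sum_(k < N.+1) cos (k%:R * x)) ^+ 2 + (\sum_(k < N.+1) sin (k%:R * x)) ^+ 2).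

Lemma fejer_ge0 N x : 0 <= fejer N x.
Proof. by rewrite mulr_ge0// addr_ge0// sqr_ge0. Qed.

(** Expanding the square separates the variables t and s; every integral
    against the kernel becomes a finite combination of Fourier coefficients,
    so that no theorem on iterated integrals is needed. *)
Lemma fejerE N t s : fejer N (t - s) = N.+1%:R^-1 *
  \sum_(kl : 'I_N.+1 * 'I_N.+1)
    (cosn (freq kl) t * cosn (freq kl) s + sinn (freq kl) t * sinn (freq kl) s).
Proof.
rewrite /fejer !expr2 !big_distrlr/= -big_split/= -(pair_bigA _ (fun k l =>
  cosn (freq (k, l)) t * cosn (freq (k, l)) s +
  sinn (freq (k, l)) t * sinn (freq (k, l)) s))/=; congr (_ * _).
apply: eq_bigr => k _; rewrite -big_split/=; apply: eq_bigr => l _.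
rewrite -cosB /cosn /sinn -cosB; congr cos.
by rewrite /freq/= intrB -!pmulrn; ring.
Qed.

(** With z = e^(ix), |1 - z|^2 = 2 (1 - cos x) and
    |1 - z|^2 |1 + z + .. + z^N|^2 = |1 - z^(N+1)|^2 <= 4. The factor 1 - cos x
    is the squared chord: the kernel has little mass away from 0. *)
Lemma fejer_decay N x : (1 - cos x) * fejer N x <= 2 / N.+1%:R.
Proof.
(* the real and imaginary parts of (1 - z) (1 + .. + z^(n-1)) = 1 - z^n *)
have E n : (1 - cos x) * (\sum_(k < n) cos (k%:R * x)) +
           sin x * (\sum_(k < n) sin (k%:R * x)) = 1 - cos (n%:R * x) /\
           (1 - cos x) * (\sum_(k < n) sin (k%:R * x)) -
           sin x * (\sum_(k < n) cos (k%:R * x)) = - sin (n%:R * x).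
  elim: n => [|n [IH1 IH2]].
    by rewrite !big_ord0 mul0r cos0 sin0 !mulr0 !subrr oppr0 addr0.
  rewrite !big_ord_recr/= -natr1 [(_ + 1) * x]mulrDl mul1r cosD sinD.
  move: IH1 IH2; set C := \sum_(_ < _) _; set S := \sum_(_ < _) _ => IH1 IH2.
  by split; lra.
have [{E}] := E N.+1; rewrite /fejer.
set C := \sum_(_ < _) _; set S := \sum_(_ < _) _ => E1 E2.
have E3 := sin2cos2 x; have E4 := sin2cos2 (N.+1%:R * x).
have E5 := cos_geN1 (N.+1%:R * x).
rewrite mulrCA mulrC ler_wpM2r// ?invr_ge0//.
have : 2 * ((1 - cos x) * (C ^+ 2 + S ^+ 2)) = 2 * (1 - cos (N.+1%:R * x)).
  transitivity ((1 - cos (N.+1%:R * x)) ^+ 2 + (- sin (N.+1%:R * x)) ^+ 2).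
    by rewrite -E1 -E2; ring: E3.
  by ring: E4.
lra.
Qed.

Lemma continuous_cosn n : continuous (cosn n).
Proof.
move=> t; apply: (@continuous_comp _ _ _ (fun t => n%:~R * t) cos).
  by apply: mulrl_continuous.
exact: continuous_cos.
Qed.

Lemma continuous_sinn n : continuous (sinn n).
Proof.
move=> t; apply: (@continuous_comp _ _ _ (fun t => n%:~R * t) sin).
  by apply: mulrl_continuous.
exact: continuous_sin.
Qed.

Lemma L1Mcosn v n : L1 v -> L1 (fun t => v t * cosn n t).
Proof.
move=> Iv; apply: (@L1Mbounded _ _ _ 1) => //.
  by apply: continuous_measurable_circle; exact: continuous_cosn.
by move=> t _; exact: cos_max.
Qed.

Lemma L1Msinn v n : L1 v -> L1 (fun t => v t * sinn n t).
Proof.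
move=> Iv; apply: (@L1Mbounded _ _ _ 1) => //.
  by apply: continuous_measurable_circle; exact: continuous_sinn.
by move=> t _; exact: sin_max.
Qed.

Definition cosco v n := circle_int (fun t => v t * cosn n t).
Definition sinco v n := circle_int (fun t => v t * sinn n t).

Lemma circle_int_derive F f : (forall t, is_derive t 1 F (f t)) -> continuous f ->
  circle_int f = F pi - F (- pi).
Proof.
move=> dF cf.
have cF : continuous F.
  move=> t; apply: differentiable_continuous; apply/derivable1_diffP.
  by case: (dF t).
have lepi : - pi < pi :> R by have := pi_gt0 R; lra.
have If : L1 f.
  have : lebesgue_measure.-integrable `[- pi, pi] (EFin \o f).
    apply: continuous_compact_integrable; first exact: segment_compact.
    exact: continuous_subspaceT.
  apply: integrableS => //=.
  - exact: measurable_circle.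
  - by apply: subset_itvl; rewrite bnd_simp.
rewrite /circle_int Rintegral_itv_bndo_bndc// /Rintegral (@continuous_FTC2 _ _ F)//.
- exact: continuous_subspaceT.
- split.
  + by move=> t _; case: (dF t).
  + by apply: cvg_at_right_filter; exact: cF.
  + by apply: cvg_at_left_filter; exact: cF.
- by move=> t _; rewrite derive1E; case: (dF t).
Qed.

Lemma sin_intpi n : sin (n%:~R * pi) = 0 :> R.
Proof.
have S m : sin (m%:R * pi) = 0 :> R.
  by rewrite mulr_natl -[X in sin X]add0r (alternatingn (@sinDpi R)) sin0 mulr0.
by case: n => m; rewrite ?NegzE ?mulrNz ?mulNr ?sinN S ?oppr0.
Qed.

Lemma cosco1 n : cosco (cst 1) n = if n == 0 then 2 * pi else 0.
Proof.
have [->|n0] := eqVneq.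
  rewrite -[RHS]mul1r -circle_int_cst; apply: eq_circle_int => t _.
  by rewrite /cosn mul0r cos0 mulr1.
have nR : n%:~R != 0 :> R by rewrite intr_eq0.
transitivity (circle_int (cosn n)).
  by apply: eq_circle_int => t _; rewrite mul1r.
pose F (t : R) := n%:~R^-1 * sin (n%:~R * t).
have dF t : is_derive t 1 F (cosn n t).
  rewrite /F; apply: is_derive_eq; rewrite /cosn /GRing.scale/=.
  by field.
rewrite (circle_int_derive dF) /F; last exact: continuous_cosn.
by rewrite mulrN sinN sin_intpi !(oppr0, mulr0, subrr).
Qed.

Lemma sinco1 n : sinco (cst 1) n = 0.
Proof.
have [->|n0] := eqVneq n 0.
  rewrite /sinco -[RHS](mul0r (2 * pi)) -circle_int_cst; apply: eq_circle_int => t _.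
  by rewrite /sinn mul0r sin0 mulr0.
have nR : n%:~R != 0 :> R by rewrite intr_eq0.
transitivity (circle_int (sinn n)).
  by apply: eq_circle_int => t _; rewrite mul1r.
pose F (t : R) := - n%:~R^-1 * cos (n%:~R * t).
have dF t : is_derive t 1 F (sinn n t).
  rewrite /F; apply: is_derive_eq; rewrite /sinn /GRing.scale/=.
  by field.
rewrite (circle_int_derive dF) /F; last exact: continuous_sinn.
by rewrite mulrN cosN subrr.
Qed.

Lemma L1_trig a b v n : L1 v ->
  L1 (fun s => a * (v s * cosn n s) + b * (v s * sinn n s)).
Proof.
by move=> Iv; apply: L1D; apply: L1Z; [exact: L1Mcosn|exact: L1Msinn].
Qed.

Lemma circle_int_trig a b v n : L1 v ->
  circle_int (fun s => a * (v s * cosn n s) + b * (v s * sinn n s)) =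
  a * cosco v n + b * sinco v n.
Proof.
move=> Iv; rewrite circle_intD.
- by rewrite !circle_intZ//; [exact: L1Msinn|exact: L1Mcosn].
- by apply: L1Z; exact: L1Mcosn.
- by apply: L1Z; exact: L1Msinn.
Qed.

Lemma mul_fejerE v N t s : v s * fejer N (t - s) = N.+1%:R^-1 *
  \sum_(kl : 'I_N.+1 * 'I_N.+1)
    (cosn (freq kl) t * (v s * cosn (freq kl) s) +
     sinn (freq kl) t * (v s * sinn (freq kl) s)).
Proof.
rewrite fejerE mulrCA mulr_sumr; congr (_ * _).
by apply: eq_bigr => kl _; ring.
Qed.

Lemma L1Mfejer N v t : L1 v -> L1 (fun s => v s * fejer N (t - s)).
Proof.
move=> Iv; under eq_fun do rewrite mul_fejerE.
by apply/L1Z/L1_sum => kl; exact: L1_trig.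
Qed.

Definition fejer_mean N v t := circle_int (fun s => v s * fejer N (t - s)).

Lemma fejer_meanE N v t : L1 v -> fejer_mean N v t = N.+1%:R^-1 *
  \sum_(kl : 'I_N.+1 * 'I_N.+1)
    (cosn (freq kl) t * cosco v (freq kl) +
     sinn (freq kl) t * sinco v (freq kl)).
Proof.
move=> Iv; rewrite /fejer_mean; under eq_fun do rewrite mul_fejerE.
rewrite circle_intZ; last by apply: L1_sum => kl; exact: L1_trig.
rewrite circle_int_sum => [|kl]; last exact: L1_trig.
by congr (_ * _); apply: eq_bigr => kl _; rewrite circle_int_trig.
Qed.

Lemma mul_fejer_meanE N u v t : L1 v ->
  u t * fejer_mean N v t = N.+1%:R^-1 *
  \sum_(kl : 'I_N.+1 * 'I_N.+1)
    (cosco v (freq kl) * (u t * cosn (freq kl) t) +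
     sinco v (freq kl) * (u t * sinn (freq kl) t)).
Proof.
move=> Iv; rewrite fejer_meanE// mulrCA mulr_sumr; congr (_ * _).
by apply: eq_bigr => kl _; ring.
Qed.

Lemma L1Mfejer_mean N u v :
  L1 u -> L1 v -> L1 (fun t => u t * fejer_mean N v t).
Proof.
move=> Iu Iv; under eq_fun do rewrite mul_fejer_meanE//.
by apply/L1Z/L1_sum => kl; exact: L1_trig.
Qed.

(** Up to the factor (2 pi)^2, the weighted Parseval sum of two functions with
    the Fejer weights 1 - |n| / (N + 1); written as a double integral it is
    symmetric, positive and bounded uniformly in N. *)
Definition pairing N u v := circle_int (fun t => u t * fejer_mean N v t).

Lemma pairingE N u v : L1 u -> L1 v -> pairing N u v = N.+1%:R^-1 *
  \sum_(kl : 'I_N.+1 * 'I_N.+1)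
    (cosco u (freq kl) * cosco v (freq kl) +
     sinco u (freq kl) * sinco v (freq kl)).
Proof.
move=> Iu Iv; rewrite /pairing; under eq_fun do rewrite mul_fejer_meanE//.
rewrite circle_intZ; last by apply: L1_sum => kl; exact: L1_trig.
rewrite circle_int_sum => [|kl]; last exact: L1_trig.
congr (_ * _); apply: eq_bigr => kl _; rewrite circle_int_trig//.
by rewrite mulrC [X in _ + X]mulrC.
Qed.

Lemma pairingC N u v : L1 u -> L1 v -> pairing N u v = pairing N v u.
Proof.
move=> Iu Iv; rewrite !pairingE//; congr (_ * _); apply: eq_bigr => kl _.
by rewrite mulrC [X in _ + X]mulrC.
Qed.

(** Only the diagonal pairs k = l contribute, by orthogonality. *)
Lemma fejer_mean1 N t : fejer_mean N (cst 1) t = 2 * pi.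
Proof.
rewrite fejer_meanE; last exact: L1_cst.
rewrite -(pair_bigA _ (fun k l =>
  cosn (freq (k, l)) t * cosco (cst 1) (freq (k, l)) +
  sinn (freq (k, l)) t * sinco (cst 1) (freq (k, l))))/=.
under eq_bigr => k _.
  rewrite (bigD1 k)//= big1 ?addr0; last first.
    move=> l lk; rewrite cosco1 sinco1 ifF ?mulr0 ?addr0//.
    by rewrite /freq/= subr_eq0 eqz_nat eq_sym; exact/negbTE.
  rewrite /freq/= subrr cosco1 sinco1 eqxx /cosn mul0r cos0 mul1r mulr0 addr0.
  over.
by rewrite sumr_const card_ord -[X in N.+1%:R^-1 * X]mulr_natl mulKf ?pnatr_eq0.
Qed.

End fejer_kernel.

(** * Convergence of the Fejer means of a continuous function *)

Section fejer_cvg.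
Context {R : realType}.
Local Notation cmfun := (measurable_fun (circle R : set (measurableTypeR R))).
Implicit Types (u v f g h : R -> R) (t s x : R).

Lemma fejer_mean_norm N v w t : L1 v -> L1 w ->
  (forall s, circle R s -> `|v s| <= w s) -> `|fejer_mean N v t| <= fejer_mean N w t.
Proof.
move=> Iv Iw vw; apply: le_norm_circle_int.
- by apply: L1_measurable; exact: L1Mfejer.
- exact: L1Mfejer.
by move=> s Is; rewrite normrM (ger0_norm (fejer_ge0 _ _)) ler_wpM2r ?fejer_ge0// vw.
Qed.

Lemma fejer_meanD N v w t : L1 v -> L1 w ->
  fejer_mean N (fun s => v s + w s) t = fejer_mean N v t + fejer_mean N w t.
Proof.
move=> Iv Iw; rewrite /fejer_mean -circle_intD; [|exact: L1Mfejer|exact: L1Mfejer].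
by apply: eq_circle_int => s _; rewrite mulrDl.
Qed.

Lemma fejer_meanZ N a v t : L1 v ->
  fejer_mean N (fun s => a * v s) t = a * fejer_mean N v t.
Proof.
move=> Iv; rewrite /fejer_mean -circle_intZ; last exact: L1Mfejer.
by apply: eq_circle_int => s _; rewrite mulrA.
Qed.

Lemma fejer_mean_cst N a t : fejer_mean N (cst a) t = a * (2 * pi).
Proof.
rewrite -(fejer_mean1 N t) -fejer_meanZ; last exact: L1_cst.
by apply: eq_circle_int => s _; rewrite mulr1.
Qed.

Lemma pairing1 N u : L1 u -> pairing N u (cst 1) = 2 * pi * circle_int u.
Proof.
move=> Iu; rewrite -circle_intZ//; apply: eq_circle_int => t _.
by rewrite fejer_mean1 mulrC.
Qed.

(** The kernel has constant mass in either variable. *)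
Lemma circle_int_fejer_mean N v : L1 v ->
  circle_int (fejer_mean N v) = 2 * pi * circle_int v.
Proof.
move=> Iv; rewrite -(pairing1 N)// pairingC//; last exact: L1_cst.
by apply: eq_circle_int => t _; rewrite mul1r.
Qed.

(** The distance |t - s| stays between d and 2 pi - d, because t is at
    distance at least d from both end points: the points e^(it) and e^(is) are
    then far apart on the circle. *)
Lemma cos_chord t s (d : R) : 0 < d -> d <= pi - `|t| -> `|s| <= pi ->
  d <= `|t - s| -> cos (t - s) <= cos d.
Proof.
move=> d0 dt sp dts; rewrite -[X in X <= _]cos_norm.
have ts : `|t - s| <= 2 * pi - d.
  by rewrite (le_trans (ler_normB _ _))//; lra.
have := pi_gt0 R => pi0.
have K (y : R) : d <= y -> y <= pi -> cos y <= cos d.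
  rewrite le_eqVlt => /predU1P[->//|dy] yp; rewrite ltW// ltr_cos// in_itv/=;
    apply/andP; split; lra.
have [|yp] := leP `|t - s| pi; first exact: K.
have -> : cos `|t - s| = cos (2 * pi - `|t - s|).
  by rewrite -cosN mulr_natl [in RHS]addrC cosD2pi.
by apply: K; lra.
Qed.

Lemma continuous_circle_bounded h : continuous h ->
  exists2 M : R, 0 <= M & forall s, `|s| <= pi -> `|h s| <= M.
Proof.
move=> ch; have := pi_gt0 R => pi0.
have [||c _ hc] := @EVT_max R (fun s => `|h s|) (- pi) pi; first by lra.
  apply: continuous_subspaceT => s; apply: cvg_norm; exact: ch.
exists `|h c| => // s; rewrite ler_norml => /andP[s1 s2]; apply: hc.
by rewrite in_itv/= s1.
Qed.

Lemma circle_norm t : circle R t -> `|t| <= pi.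
Proof.
by rewrite /circle/= in_itv/= => /andP[t1 t2]; rewrite ler_norml t1 ltW.
Qed.

(** Continuity at the interior point t and boundedness give
    |h(s) - h(t)| <= e + C (1 - cos (t - s)); integrated against the kernel,
    the first term contributes 2 pi e and the second is O(1 / N) by
    [fejer_decay]. At -pi the periodic extension of h may jump, whence the
    restriction on t. *)
Lemma fejer_cvg h t : continuous h -> - pi < t -> t < pi ->
  fejer_mean N h t @[N --> \oo] --> 2 * pi * h t.
Proof.
move=> ch t1 t2.
have pi0 := pi_gt0 R; have pin0 := lt0r_neq0 pi0.
have [M M0 hM] := continuous_circle_bounded ch.
have Ih : L1 h.
  apply: (L1_bounded (M := M)); first exact: continuous_measurable_circle.
  by move=> s Is; apply: hM; exact: circle_norm.
have chord (e : R) : 0 < e -> exists2 C : R, 0 <= C &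
    forall s, circle R s -> `|h s - h t| <= e + C * (1 - cos (t - s)).
  move=> e0.
  have /cvgrPdist_le/(_ e e0)/nbhs_ballP[d /= d0 hd] := ch t.
  have tpi : `|t| < pi by rewrite ltr_norml t1.
  (* a chord radius within the continuity radius, not reaching the end points *)
  pose d' := Num.min (d / 2) (pi - `|t|).
  have d'0 : 0 < d' by rewrite lt_min divr_gt0//= subr_gt0.
  have d'pi : d' <= pi - `|t| by rewrite ge_min lexx orbT.
  have d'd : d' < d by rewrite gt_min; apply/orP; left; lra.
  have d'le : d' <= pi by apply: le_trans d'pi _; rewrite gerBl.
  have cd : 0 < 1 - cos d'.
    rewrite subr_gt0 -[X in _ < X]cos0 ltr_cos// in_itv/=; apply/andP; split=> //; lra.
  exists (2 * M / (1 - cos d')); first by rewrite divr_ge0 ?mulr_ge0// ltW.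
  move=> s /circle_norm sp.
  have [ds|ds] := leP d' `|t - s|.
    have := cos_chord d'0 d'pi sp ds => cts.
    have CE : 2 * M / (1 - cos d') * (1 - cos d') = 2 * M by rewrite divfK ?gt_eqF.
    have : 2 * M / (1 - cos d') * (1 - cos d') <=
           2 * M / (1 - cos d') * (1 - cos (t - s)).
      by rewrite ler_wpM2l ?divr_ge0 ?mulr_ge0 ?(ltW cd)//; lra.
    have hst : `|h s - h t| <= 2 * M.
      rewrite (le_trans (ler_normB _ _))// mulr_natl mulr2n lerD ?hM//; exact: ltW.
    lra.
  rewrite distrC -[X in X <= _]addr0 lerD//.
    by apply: hd; rewrite /ball/= (lt_trans ds).
  by apply: mulr_ge0; rewrite ?divr_ge0 ?mulr_ge0 ?(ltW cd)// subr_ge0 cos_le1.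
apply/cvgrPdist_le => /= e e0.
have e0' : 0 < e / (4 * pi) by rewrite divr_gt0 ?mulr_gt0.
have [C C0 hC] := chord _ e0'.
have D0 : 0 < e / (8 * pi * (C + 1)).
  by rewrite divr_gt0// mulr_gt0 ?mulr_gt0// ltr_wpDl.
near=> N.
have IK a : L1 (fun s => a * fejer N (t - s)).
  by apply: (L1Mfejer N t (L1_cst a)).
have Ic : L1 (fun s => h s - h t) by apply: L1B => //; exact: L1_cst.
rewrite distrC; have -> : fejer_mean N h t - 2 * pi * h t =
    circle_int (fun s => (h s - h t) * fejer N (t - s)).
  rewrite (mulrC _ (h t)) -(fejer_mean_cst N _ t) -circle_intB//; last 2 first.
  - exact: L1Mfejer.
  - exact: IK.
  by apply: eq_circle_int => s _; rewrite mulrBl.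
apply: (@le_trans _ _ (circle_int (fun s => (e / (4 * pi)) * fejer N (t - s) +
                                       C * (2 / N.+1%:R)))).
  apply: le_norm_circle_int.
  - by apply: L1_measurable; exact: L1Mfejer.
  - by apply: L1D; [exact: IK|exact: L1_cst].
  move=> s Is; rewrite normrM (ger0_norm (fejer_ge0 _ _)).
  apply: le_trans (ler_wpM2r (fejer_ge0 _ _) (hC _ Is)) _.
  by rewrite mulrDl lerD2l -mulrA ler_wpM2l// fejer_decay.
rewrite circle_intD; [|exact: IK|exact: L1_cst].
rewrite [X in X + _](fejer_mean_cst N (e / (4 * pi)) t) [X in _ + X]circle_int_cst.
have -> : e / (4 * pi) * (2 * pi) = e / 2.
  by move: pin0; generalize (@pi R) => P P0; field.
have N1 : N.+1%:R^-1 < e / (8 * pi * (C + 1)).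
  by near: N; exact: (near_infty_natSinv_lt (PosNum D0)).
rewrite [leRHS](splitr e) lerD2l.
apply: (@le_trans _ _ (C * 4 * pi * (e / (8 * pi * (C + 1))))).
  rewrite (_ : C * _ * _ = C * 4 * pi * N.+1%:R^-1); last by ring.
  by rewrite ler_wpM2l// ?mulr_ge0// ltW.
rewrite (_ : C * 4 * pi * _ = e / 2 * (C / (C + 1))); last first.
  have C1 : C + 1 != 0 by rewrite gt_eqF// ltr_wpDl.
  by move: pin0; generalize (@pi R) => P P0; field; rewrite P0 C1.
rewrite ler_piMr//; first by rewrite divr_ge0 ?ltW.
by rewrite ler_pdivrMr ?ltr_wpDl// mul1r lerDl.
Unshelve. all: by end_near. Qed.

(** Dominated convergence, with pointwise convergence waived at -pi, where
    [fejer_cvg] gives nothing. *)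
Lemma circle_int_dominated (F : nat -> R -> R) (f G : R -> R) :
  (forall N, cmfun (F N)) -> cmfun f -> L1 G ->
  (forall N t, circle R t -> `|F N t| <= G t) ->
  (forall t, circle R t -> t != - pi -> F N t @[N --> \oo] --> f t) ->
  circle_int (F N) @[N --> \oo] --> circle_int f.
Proof.
move=> mF mf IG FG Ff.
have [|||||If _ ] := @dominated_convergence _ _ R lebesgue_measure (circle R)
   measurable_circle (fun N => EFin \o F N) (EFin \o f) (EFin \o G).
- by move=> N; apply/measurable_EFinP.
- by apply/measurable_EFinP.
- exists [set - pi]; split => //; first exact: lebesgue_measure_set1.
  move=> t /=; apply: contra_notP => /eqP tpi It.
  by apply: cvg_EFin; [exact: nearW|exact: Ff].
- exact: IG.
- by apply: aeW => t N It /=; rewrite lee_fin FG.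
move=> /= H; apply: fine_cvg.
rewrite /circle_int /Rintegral fineK//; apply: integrable_fin_num => //.
exact: measurable_circle.
Qed.

End fejer_cvg.

(** * Convergence of the Fejer pairing *)

Section pairing_cvg.
Context {R : realType}.
Local Notation cmfun := (measurable_fun (circle R : set (measurableTypeR R))).
Implicit Types (u v f g h c : R -> R) (t s x M : R).

(** The estimate on a N - b N is uniform in N, so letting N grow commutes with
    letting e tend to 0. *)
Lemma cvg_approx (a : nat -> R) (l : R) :
  (forall e : R, 0 < e -> exists b : nat -> R, exists m : R,
    [/\ b N @[N --> \oo] --> m, `|l - m| <= e & forall N, `|a N - b N| <= e]) ->
  a N @[N --> \oo] --> l.
Proof.
move=> H; apply/cvgrPdist_le => /= e e0.
have e3 : 0 < e / 3 by rewrite divr_gt0.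
have [b [m [/cvgrPdist_le/(_ _ e3) bm lm ab]]] := H _ e3.
near=> N.
have -> : l - a N = (l - m) + (m - b N) - (a N - b N) by ring.
rewrite (le_trans (ler_normB _ _))//.
have {1}-> : e = e / 3 + e / 3 + e / 3 by field.
rewrite lerD// (le_trans (ler_normD _ _))// lerD//.
by near: N.
Unshelve. all: by end_near. Qed.

(** Integrating A(t) + B(s) against the kernel gives 2 pi times each integral,
    since the kernel is nonnegative with mass 2 pi in either variable. With
    A = 0 this bounds the pairing of a bounded and an integrable function;
    with Young's inequality, that of functions in dual Lebesgue spaces. *)
Lemma pairing_bound N u v A B : L1 u -> L1 v -> L1 A -> L1 B ->
  (forall t s, circle R t -> circle R s -> `|u t| * `|v s| <= A t + B s) ->
  `|pairing N u v| <= 2 * pi * (circle_int A + circle_int B).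
Proof.
move=> Iu Iv IA IB uvAB.
have IMB : L1 (fun t => 1 * fejer_mean N B t) by apply: L1Mfejer_mean => //; exact: L1_cst.
have -> : 2 * pi * (circle_int A + circle_int B) =
    circle_int (fun t => 2 * pi * A t + 1 * fejer_mean N B t).
  rewrite circle_intD//; last exact: L1Z.
  rewrite mulrDr (circle_intZ (2 * pi) IA) -(circle_int_fejer_mean N IB); congr (_ + _).
  by apply: eq_circle_int => t _; rewrite mul1r.
apply: le_norm_circle_int.
- by apply: L1_measurable; exact: L1Mfejer_mean.
- by apply: L1D => //; exact: L1Z.
move=> t It; rewrite -fejer_meanZ// mul1r (mulrC _ (A t)) -(fejer_mean_cst N (A t) t).
rewrite -fejer_meanD//; last exact: L1_cst.
apply: fejer_mean_norm; first exact: L1Z.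
  by apply: L1D => //; exact: L1_cst.
by move=> s Is; rewrite normrM; exact: uvAB.
Qed.

Lemma pairingB N u u' v : L1 u -> L1 u' -> L1 v ->
  pairing N (fun t => u t - u' t) v = pairing N u v - pairing N u' v.
Proof.
move=> Iu Iu' Iv; rewrite /pairing -circle_intB; [|exact: L1Mfejer_mean..].
by apply: eq_circle_int => t _; rewrite mulrBl.
Qed.

Lemma pairing_cvg_continuous g h M :
  cmfun g -> (forall t, circle R t -> `|g t| <= M) -> continuous h ->
  pairing N g h @[N --> \oo] --> 2 * pi * circle_int (fun t => g t * h t).
Proof.
move=> mg gM ch; have [K K0 hK] := continuous_circle_bounded ch.
have Ig := L1_bounded mg gM.
have mh := continuous_measurable_circle ch.
have Ih : L1 h by apply: (L1_bounded mh) => t It; apply: hK; exact: circle_norm.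
rewrite -circle_intZ; last first.
  by apply: (L1Mbounded (M := K)) => // t It; apply: hK; exact: circle_norm.
apply: (circle_int_dominated (G := cst (M * (K * (2 * pi))))).
- by move=> N; apply: L1_measurable; exact: L1Mfejer_mean.
- apply: L1_measurable; apply: L1Z.
  by apply: (L1Mbounded (M := K)) => // t It; apply: hK; exact: circle_norm.
- exact: L1_cst.
- move=> N t It /=; rewrite normrM ler_pM ?gM// -(fejer_mean_cst N K t).
  apply: fejer_mean_norm => //; first exact: L1_cst.
  by move=> s Is; apply: hK; exact: circle_norm.
- move=> t It tpi; rewrite mulrCA; apply: cvgM; first exact: cvg_cst.
  move: It; rewrite /circle/= in_itv/= => /andP[t1 t2].
  by apply: fejer_cvg => //; rewrite lt_neqAle eq_sym tpi.
Qed.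

Lemma L1_dense_continuous h (e : R) : L1 h -> 0 < e ->
  exists k : R -> R, [/\ continuous k, L1 k & circle_int (fun t => `|h t - k t|) <= e].
Proof.
move=> Ih e0.
have [|g_ [cg Ig /fine_cvgP[_ /cvgrPdist_le/(_ _ e0)]]] :=
  @approximation_continuous_integrable R (circle R) h measurable_circle _ Ih.
  by rewrite [X in (X < _)%E](_ : _ = (2 * pi)%:E) ?ltry//; exact: circle_measure.
move=> [N _ /(_ N (leqnn _))/=]; rewrite sub0r normrN => gN.
by exists (g_ N); split; [exact: cg|exact: Ig|exact: le_trans (ler_norm _) gN].
Qed.

(** Replacing h by a continuous k changes both sides by at most
    2 pi M int |h - k|, whatever N. *)
Lemma pairing_cvg_bounded g h M :
  cmfun g -> (forall t, circle R t -> `|g t| <= M) -> L1 h ->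
  pairing N g h @[N --> \oo] --> 2 * pi * circle_int (fun t => g t * h t).
Proof.
move=> mg gM Ih; apply: cvg_approx => e e0.
have pi0 := @pi2_gt0 R.
have M0 : 0 <= M.
  apply: le_trans (gM (- pi) _); rewrite // /circle/= in_itv/= lexx/=.
  by have := pi_gt0 R; lra.
have d0 : 0 < e / (2 * pi * (M + 1)) by rewrite divr_gt0// mulr_gt0// ltr_wpDl.
have [k [ck Ik hk]] := L1_dense_continuous Ih d0.
have Ig := L1_bounded mg gM.
have Ihk : L1 (fun t => h t - k t) by exact: L1B.
have Ink : L1 (fun t => M * `|h t - k t|) by apply: L1Z; exact: L1_norm.
have E : 2 * pi * circle_int (fun t => M * `|h t - k t|) <= e.
  rewrite circle_intZ; last exact: L1_norm.
  apply: le_trans (_ : 2 * pi * (M * (e / (2 * pi * (M + 1)))) <= _).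
    by rewrite ler_wpM2l ?(ltW pi0)// ler_wpM2l.
  have M1 : 0 < M + 1 by rewrite ltr_wpDl.
  have -> : 2 * pi * (M * (e / (2 * pi * (M + 1)))) = e * (M / (M + 1)).
    have := lt0r_neq0 pi0; generalize (2 * @pi R) => P P0.
    by field; rewrite P0 lt0r_neq0.
  by rewrite ler_piMr ?(ltW e0)// ler_pdivrMr// mul1r lerDl.
have mul f : L1 f -> L1 (fun t => g t * f t).
  move=> If; rewrite [X in L1 X](_ : _ = fun t => f t * g t).
    exact: (L1Mbounded If mg gM).
  by apply/funext => t; rewrite mulrC.
exists (fun N => pairing N g k), (2 * pi * circle_int (fun t => g t * k t)); split.
- exact: (pairing_cvg_continuous mg gM ck).
- rewrite -mulrBr normrM (gtr0_norm pi0) -circle_intB; [|exact: mul..].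
  apply: le_trans E; rewrite ler_wpM2l ?(ltW pi0)//; apply: le_norm_circle_int => //.
    by apply: L1_measurable; apply: L1B; exact: mul.
  by move=> t It; rewrite -mulrBr normrM ler_wpM2r// gM.
- move=> N; rewrite pairingC// [in X in _ - X]pairingC// -pairingB//.
  rewrite pairingC//; apply: le_trans E.
  have -> : circle_int (fun t => M * `|h t - k t|) =
      circle_int (cst 0) + circle_int (fun t => M * `|h t - k t|).
    by rewrite circle_int_cst mul0r add0r.
  apply: pairing_bound => //; first exact: L1_cst.
  by move=> t s It Is /=; rewrite add0r ler_wpM2r// gM.
Qed.

(** x^n y is at most the (n + 1)-st power of the larger of x and y; the sharp
    constants do not matter for integrability and limits. *)
Lemma young_crude (x y : R) n : 0 <= x -> 0 <= y ->
  x ^+ n * y <= x ^+ n.+1 + y ^+ n.+1.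
Proof.
move=> x0 y0; rewrite !exprSr; have [xy|yx] := leP x y.
  rewrite ler_wpDl ?mulr_ge0 ?exprn_ge0// ler_wpM2r//.
  by rewrite lerXn2r ?nnegrE.
by rewrite ler_wpDr ?mulr_ge0 ?exprn_ge0// ler_wpM2l ?exprn_ge0// ltW.
Qed.

(** Apply the crude inequality to x / d and d^n y: the second term can be made
    small at the expense of the first. *)
Lemma young_scaled (x y d : R) n : (0 < n)%N -> 0 <= x -> 0 <= y -> 0 < d -> d <= 1 ->
  x ^+ n * y <= d^-1 ^+ n.+1 * x ^+ n.+1 + d * y ^+ n.+1.
Proof.
move=> n0 x0 y0 d0 d1.
have -> : x ^+ n * y = (d^-1 * x) ^+ n * (d ^+ n * y).
  rewrite exprMn mulrACA -exprMn mulVf ?gt_eqF// expr1n mul1r//.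
apply: le_trans (young_crude _ _ _) _.
- by rewrite mulr_ge0// invr_ge0 ltW.
- by rewrite mulr_ge0// exprn_ge0// ltW.
rewrite !exprMn lerD2l ler_wpM2r ?exprn_ge0// -exprM.
rewrite -[leRHS]expr1; apply: ler_wiXn2l => //; first exact: ltW.
by rewrite muln_gt0 n0.
Qed.

Lemma measurable_truncate c (a b : R -> R) (m : R) :
  cmfun c -> cmfun a -> cmfun b ->
  cmfun (fun t => if c t <= m then a t else b t).
Proof.
move=> mc ma mb; apply: measurable_fun_if.
- exact: measurable_circle.
- by apply: measurable_fun_ler => //; exact: measurable_cst.
- by apply: measurable_funS ma => //; exact: measurable_circle.
- by apply: measurable_funS mb => //; exact: measurable_circle.
Qed.

Lemma circle_int_tail_cvg0 c n :
  cmfun c -> L1 (fun t => c t ^+ n.+1) ->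
  circle_int (fun t => if c t <= m%:R then 0 else c t ^+ n.+1) @[m --> \oo] --> 0.
Proof.
move=> mc Ic; rewrite -[X in _ --> X](mul0r (2 * pi)) -(circle_int_cst 0).
apply: (circle_int_dominated (G := fun t => `|c t ^+ n.+1|)).
- move=> m; apply: (measurable_truncate (a := cst 0)) => //.
  exact: measurable_funX.
- exact: measurable_cst.
- exact: L1_norm.
- by move=> m t It; case: ifP => //; rewrite normr0.
- move=> t It _; apply: cvg_near_cst; near=> m; rewrite ifT//.
  near: m; exact: nbhs_infty_ger.
Unshelve. all: by end_near. Qed.

(** The modulus bound |g| <= c^n, with c^(n+1) integrable, says that g lies in
    L^((n+1)/n) while using integer powers only. Truncate g where c > m: first
    the parameter d of [young_scaled] makes the contribution of h small, then
    m makes the tail of c^(n+1) small. *)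
Lemma pairing_cvg c g h n : (0 < n)%N ->
  cmfun c -> cmfun g -> cmfun h ->
  (forall t, 0 <= c t) -> (forall t, circle R t -> `|g t| <= c t ^+ n) ->
  L1 (fun t => c t ^+ n.+1) -> L1 (fun t => `|h t| ^+ n.+1) ->
  pairing N g h @[N --> \oo] --> 2 * pi * circle_int (fun t => g t * h t).
Proof.
move=> n0 mc mg mh c0 gc Ic Ih.
have pi0 := @pi2_gt0 R.
have pow1 (x : R) : 0 <= x -> x <= 1 + x ^+ n.+1.
  by move=> x0; have := young_crude n ler01 x0; rewrite !expr1n mul1r.
have pown (x : R) : 0 <= x -> x ^+ n <= x ^+ n.+1 + 1.
  by move=> x0; have := young_crude n x0 ler01; rewrite expr1n mulr1.
have I1 : L1 (cst (1 : R)) by exact: L1_cst.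
have Ig : L1 g.
  apply: (L1_le mg _ (L1D Ic I1)) => t It.
  by rewrite (le_trans (gc _ It))// pown.
have Ih1 : L1 h by apply: (L1_le mh _ (L1D I1 Ih)) => t It; exact: pow1.
apply: cvg_approx => e e0.
pose H := circle_int (fun t => `|h t| ^+ n.+1).
have H0 : 0 <= H by apply: circle_int_ge0 => t _; rewrite exprn_ge0.
pose e' := e / (2 * pi) / 2.
have e'0 : 0 < e' by rewrite !divr_gt0.
have e'E : 2 * pi * (e' + e') = e.
  by rewrite /e'; have := lt0r_neq0 pi0; generalize (2 * @pi R) => P P0; field.
pose d := Num.min 1 (e' / (1 + H)).
have H1 : 0 < 1 + H by rewrite ltr_pwDl.
have d0 : 0 < d by rewrite lt_min ltr01 divr_gt0.
have d1 : d <= 1 by rewrite ge_min lexx.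
have dH : d * H <= e'.
  apply: le_trans (_ : e' / (1 + H) * H <= _).
    by rewrite ler_wpM2r// ge_min lexx orbT.
  by rewrite mulrAC ler_pdivrMr// ler_pM2l// lerDr.
have k0 : 0 < d^-1 ^+ n.+1 by rewrite exprn_gt0// invr_gt0.
have /cvgrPdist_le/(_ (e' / d^-1 ^+ n.+1)) := circle_int_tail_cvg0 mc Ic.
move=> /(_ (divr_gt0 e'0 k0))[m _ /(_ m (leqnn m))/=].
set T := circle_int _; rewrite sub0r normrN => Tle.
have {}Tle : d^-1 ^+ n.+1 * T <= e'.
  by rewrite mulrC -ler_pdivlMr//; exact: le_trans (ler_norm _) Tle.
pose gm t := if c t <= m%:R then g t else 0.
have mgm : cmfun gm.
  exact: (measurable_truncate (b := cst 0)).
have gmM t : circle R t -> `|gm t| <= m%:R ^+ n.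
  move=> It; rewrite /gm; case: ifPn => [ctm|_]; last by rewrite normr0 exprn_ge0.
  by rewrite (le_trans (gc _ It))// lerXn2r ?nnegrE.
have Igm := L1_bounded mgm gmM.
pose A t := d^-1 ^+ n.+1 * (if c t <= m%:R then 0 else c t ^+ n.+1).
pose B t := d * `|h t| ^+ n.+1.
have IT : L1 (fun t => if c t <= m%:R then 0 else c t ^+ n.+1).
  apply: (L1_le _ _ Ic).
    by apply: (measurable_truncate (a := cst 0)) => //; exact: measurable_funX.
  by move=> t It; case: ifP => _; rewrite ?normr0 ?exprn_ge0// ger0_norm// exprn_ge0.
have IA : L1 A by exact: L1Z.
have IB : L1 B by exact: L1Z.
have AB : 2 * pi * (circle_int A + circle_int B) <= e.
  by rewrite -e'E ler_wpM2l ?(ltW pi0)// lerD// /A /B circle_intZ.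
have gmAB t s : circle R t -> circle R s -> `|g t - gm t| * `|h s| <= A t + B s.
  move=> It Is; rewrite /A /B /gm; case: ifPn => _.
    by rewrite subrr normr0 mul0r mulr0 add0r mulr_ge0 ?exprn_ge0// ltW.
  rewrite subr0 (le_trans _ (young_scaled n0 (c0 t) (normr_ge0 (h s)) d0 d1))//.
  by rewrite ler_wpM2r// gc.
have Igh : L1 (fun t => g t * h t).
  apply: (L1_le (measurable_funM mg mh) _ (L1D Ic Ih)) => t It.
  rewrite normrM (le_trans _ (young_crude _ _ _))//.
  by rewrite ler_wpM2r// gc.
have Igmh : L1 (fun t => gm t * h t).
  rewrite [X in L1 X](_ : _ = fun t => h t * gm t).
    exact: (L1Mbounded Ih1 mgm gmM).
  by apply/funext => t; rewrite mulrC.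
exists (fun N => pairing N gm h), (2 * pi * circle_int (fun t => gm t * h t)); split.
- exact: (pairing_cvg_bounded mgm gmM Ih1).
- rewrite -mulrBr normrM (gtr0_norm pi0) -circle_intB//.
  apply: le_trans AB; rewrite ler_wpM2l ?(ltW pi0)// -circle_intD//.
  apply: le_norm_circle_int; first by apply: L1_measurable; exact: L1B.
    exact: L1D.
  by move=> t It; rewrite -mulrBl normrM gmAB.
- move=> N; rewrite -pairingB//; apply: le_trans AB.
  by apply: pairing_bound => //; exact: L1B.
Qed.

End pairing_cvg.

(** * Complex moduli and the case of equality in Young's inequality *)

Section complex_facts.
Context {R : realType}.
Implicit Types (z w g h : R[i]).

Lemma cmodE z : cmod z ^+ 2 = complex.Re z ^+ 2 + complex.Im z ^+ 2.
Proof. by case: z => a b; rewrite /cmod/= sqr_sqrtr// addr_ge0// sqr_ge0. Qed.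

Lemma cmod_ge0 z : 0 <= cmod z.
Proof. by case: z => a b; rewrite /cmod/= sqrtr_ge0. Qed.

Lemma cmodM z w : cmod (z * w) = cmod z * cmod w.
Proof. exact: ComplexField.Normc.normcM. Qed.

Lemma cmodX z n : cmod (z ^+ n) = cmod z ^+ n.
Proof.
elim: n => [|n IH]; first by rewrite !expr0 /cmod ComplexField.Normc.normc1.
by rewrite !exprS cmodM IH.
Qed.

Lemma cmod_conj z : cmod (conjc z) = cmod z.
Proof. by case: z => a b; rewrite /cmod/= sqrrN. Qed.

Lemma cmod_eq0 z : cmod z = 0 -> z = 0.
Proof. exact: ComplexField.Normc.eq0_normc. Qed.

Lemma Re_le_cmod z : `|complex.Re z| <= cmod z.
Proof.
rewrite -(ler_pXn2r (n := 2)) ?nnegrE ?cmod_ge0//.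
by rewrite real_normK ?num_real// cmodE lerDl sqr_ge0.
Qed.

Lemma Im_le_cmod z : `|complex.Im z| <= cmod z.
Proof.
rewrite -(ler_pXn2r (n := 2)) ?nnegrE ?cmod_ge0//.
by rewrite real_normK ?num_real// cmodE lerDr sqr_ge0.
Qed.

Lemma Re_mulconj z w :
  complex.Re (z * conjc w) =
  complex.Re z * complex.Re w + complex.Im z * complex.Im w.
Proof. by case: z w => a b [c d] /=; ring. Qed.

Lemma mul_conj z : z * conjc z = (cmod z ^+ 2)%:C%C.
Proof.
rewrite cmodE; case: z => a b /=; apply/eqP; rewrite eq_complex/=.
by apply/andP; split; apply/eqP; ring.
Qed.

Lemma double_pred_gt0 j : (0 < j)%N -> (0 < (2 * j).-1)%N.
Proof. by case: j => // j _; rewrite mulnS. Qed.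

Lemma double_predK j : (0 < j)%N -> (2 * j).-1.+1 = (2 * j)%N.
Proof. by move=> j0; rewrite prednK// muln_gt0. Qed.

Lemma conj_product_mulconj j z : (0 < j)%N ->
  conjc z ^+ j.-1 * z ^+ j * conjc z = (cmod z ^+ (2 * j))%:C%C.
Proof.
case: j => // j _; rewrite /= mulrAC -exprSr -exprMn mulrC mul_conj -rmorphXn/=.
by rewrite -exprM.
Qed.

Lemma cmod_conj_product j z : (0 < j)%N ->
  cmod (conjc z ^+ j.-1 * z ^+ j) = cmod z ^+ (2 * j).-1.
Proof.
case: j => // j _; rewrite cmodM !cmodX cmod_conj -exprD; congr (_ ^+ _).
by rewrite mulnS mul2n -addnn/= addnS.
Qed.

(** Induction on n through the identity
    D_(n+1) = b D_n + (n + 1) c^n (b - c)^2, where D_n is the right-hand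
    side. The lower bound exhibits the case of equality b = c. *)
Lemma amgm_defect (b c : R) n : 0 <= b -> 0 <= c ->
  n%:R * c ^+ n.-1 * (b - c) ^+ 2 <=
  n%:R * c ^+ n.+1 + b ^+ n.+1 - n.+1%:R * (c ^+ n * b).
Proof.
move=> b0 c0; elim: n => [|n IH].
  by rewrite !mul0r !expr1 expr0 mul1r mul1r add0r subrr.
have D : 0 <= n%:R * c ^+ n.+1 + b ^+ n.+1 - n.+1%:R * (c ^+ n * b).
  by apply: le_trans IH; rewrite mulr_ge0 ?sqr_ge0// mulr_ge0// exprn_ge0.
have -> : n.+1%:R * c ^+ n.+2 + b ^+ n.+2 - n.+2%:R * (c ^+ n.+1 * b) =
   b * (n%:R * c ^+ n.+1 + b ^+ n.+1 - n.+1%:R * (c ^+ n * b)) +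
   n.+1%:R * c ^+ n * (b - c) ^+ 2.
  by rewrite -!natr1 !exprS; ring.
by rewrite lerDr mulr_ge0.
Qed.

Lemma amgm (b c : R) n : 0 <= b -> 0 <= c ->
  n.+1%:R * (c ^+ n * b) <= n%:R * c ^+ n.+1 + b ^+ n.+1.
Proof.
move=> b0 c0; rewrite -subr_ge0; apply: le_trans (amgm_defect n b0 c0).
by rewrite mulr_ge0 ?sqr_ge0// mulr_ge0// exprn_ge0.
Qed.

Lemma amgm_eq (b c : R) n : (0 < n)%N -> 0 <= b -> 0 <= c ->
  n.+1%:R * (c ^+ n * b) = n%:R * c ^+ n.+1 + b ^+ n.+1 -> b = c.
Proof.
move=> n0 b0 c0 E; have := amgm_defect n b0 c0; rewrite E subrr => D.
(* at c = 0 the quadratic lower bound may vanish; the equation gives b = 0 *)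
have [c00|cn0] := eqVneq c 0.
  move: E; rewrite c00 !expr0n !gtn_eqF//= mul0r mulr0 mulr0 add0r => /esym/eqP.
  by rewrite expf_eq0/= => /eqP.
have : n%:R * c ^+ n.-1 * (b - c) ^+ 2 == 0.
  by rewrite eq_le D mulr_ge0 ?sqr_ge0// mulr_ge0// exprn_ge0.
rewrite !mulf_eq0 pnatr_eq0 gtn_eqF//= expf_eq0 (negbTE cn0) andbF/=.
by rewrite ?orbb subr_eq0 => /eqP.
Qed.

Lemma duality_le g h (c : R) n : 0 <= c -> cmod g = c ^+ n ->
  n.+1%:R * complex.Re (g * conjc h) <= n%:R * c ^+ n.+1 + cmod h ^+ n.+1.
Proof.
move=> c0 gc; apply: le_trans (amgm n (cmod_ge0 h) c0).
rewrite ler_wpM2l// -gc -(cmod_conj h) -cmodM.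
exact: le_trans (ler_norm _) (Re_le_cmod _).
Qed.

(** Equality holds both in Re (g conj h) <= |g| |h| and in Young's inequality,
    so c = |h| and g conj(h) is the nonnegative real |h|^(2j), which is also
    the value of (conj(h)^(j-1) h^j) conj(h); cancel conj(h) when h <> 0. *)
Lemma duality_eq g h (c : R) j : (0 < j)%N -> 0 <= c ->
  cmod g = c ^+ (2 * j).-1 ->
  (2 * j)%:R * complex.Re (g * conjc h) =
    (2 * j).-1%:R * c ^+ (2 * j) + cmod h ^+ (2 * j) ->
  g = conjc h ^+ j.-1 * h ^+ j.
Proof.
move=> j0 c0 gc E.
have n0 := double_pred_gt0 j0.
have nE := double_predK j0.
have Rle : complex.Re (g * conjc h) <= c ^+ (2 * j).-1 * cmod h.
  rewrite -gc -(cmod_conj h) -cmodM.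
  exact: le_trans (ler_norm _) (Re_le_cmod _).
have A : (2 * j).-1.+1%:R * (c ^+ (2 * j).-1 * cmod h) =
         (2 * j).-1%:R * c ^+ (2 * j).-1.+1 + cmod h ^+ (2 * j).-1.+1.
  apply/eqP; rewrite eq_le amgm ?cmod_ge0//= !nE -E.
  by rewrite ler_pM2l ?ltr0n ?muln_gt0.
have hc := amgm_eq n0 (cmod_ge0 h) c0 A.
have [h0|hn0] := eqVneq h 0.
  have g0 : g = 0.
    apply: cmod_eq0; rewrite gc -hc h0 /cmod ComplexField.Normc.normc0.
    by rewrite expr0n gtn_eqF.
  by rewrite g0 h0 [0 ^+ j]expr0n gtn_eqF// mulr0.
have ReE : complex.Re (g * conjc h) = cmod (g * conjc h).
  rewrite cmodM cmod_conj gc; move: E; rewrite -nE -A => /mulfI; apply.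
  by rewrite pnatr_eq0.
have ImE : complex.Im (g * conjc h) = 0.
  have := cmodE (g * conjc h); rewrite -ReE -[LHS]addr0 => /addrI/esym/eqP.
  by rewrite expf_eq0/= => /eqP.
have hj0 : conjc h != 0 by rewrite conjc_eq0.
apply: (mulIf hj0); rewrite conj_product_mulconj//.
move: ReE ImE; rewrite cmodM cmod_conj gc -hc -exprSr nE.
by case: (g * _) => a b /= -> ->.
Qed.

(** The modulus of z is recovered from |z|^(2j-1), then z from
    |z|^(2j-2) z. *)
Lemma conj_product_inj j z w : (0 < j)%N ->
  conjc z ^+ j.-1 * z ^+ j = conjc w ^+ j.-1 * w ^+ j -> z = w.
Proof.
move=> j0 E.
have n0 := double_pred_gt0 j0.
have zw : cmod z = cmod w.
  apply/eqP; rewrite -(eqrXn2 n0 (cmod_ge0 z) (cmod_ge0 w)).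
  by rewrite -!cmod_conj_product// E.
have P u : conjc u ^+ j.-1 * u ^+ j = (u * conjc u) ^+ j.-1 * u.
  by case: j j0 {E n0} => // j _; rewrite exprMn [u ^+ j.+1]exprSr/=; ring.
have [w0|wn0] := eqVneq (cmod w) 0.
  by rewrite (cmod_eq0 w0); apply: cmod_eq0; rewrite zw.
move: E; rewrite !P !mul_conj zw => /mulfI; apply.
by rewrite expf_neq0// fmorph_eq0 expf_neq0.
Qed.

End complex_facts.

(** * Fourier coefficients and the complex pairing *)

Section fourier_pairing.
Context {R : realType}.
Local Notation cmfun := (measurable_fun (circle R : set (measurableTypeR R))).
Implicit Types (u v c : R -> R) (F G H J : R -> R[i]) (n : int).

Definition re F t := complex.Re (F t).
Definition im F t := complex.Im (F t).

Lemma coscoN u n : cosco u (- n) = cosco u n.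
Proof.
by apply: eq_circle_int => t _; rewrite /cosn mulrNz mulNr cosN.
Qed.

Lemma sincoN u n : L1 u -> sinco u (- n) = - sinco u n.
Proof.
move=> Iu; rewrite -[RHS]mulN1r /sinco -circle_intZ; last exact: L1Msinn.
by apply: eq_circle_int => t _; rewrite /sinn mulrNz mulNr sinN; ring.
Qed.

Lemma Re_fourier F n : L1 (re F) -> L1 (im F) ->
  complex.Re (fourier F n) = (2 * pi)^-1 * (cosco (re F) n + sinco (im F) n).
Proof.
move=> I1 I2; rewrite /cosco /sinco -circle_intD; [|exact: L1Mcosn|exact: L1Msinn].
rewrite /fourier/= mul0r subr0; congr (_ * _); apply: eq_circle_int => t _.
rewrite /expi /re /im /cosn /sinn; case: (F t) => a b /=.
by rewrite cosN sinN; ring.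
Qed.

Lemma Im_fourier F n : L1 (re F) -> L1 (im F) ->
  complex.Im (fourier F n) = (2 * pi)^-1 * (cosco (im F) n - sinco (re F) n).
Proof.
move=> I1 I2; rewrite /cosco /sinco -circle_intB; [|exact: L1Mcosn|exact: L1Msinn].
rewrite /fourier/= mul0r addr0; congr (_ * _); apply: eq_circle_int => t _.
rewrite /expi /re /im /cosn /sinn; case: (F t) => a b /=.
by rewrite cosN sinN; ring.
Qed.

Definition real_fourier F := forall n, complex.Im (fourier F n) = 0.

(** Real coefficients mean that cosco (im F) = sinco (re F) at every
    frequency; the former is even and the latter odd in n, so both vanish. *)
Lemma real_fourier_cross F n : L1 (re F) -> L1 (im F) -> real_fourier F ->
  cosco (im F) n = 0 /\ sinco (re F) n = 0.
Proof.
move=> I1 I2 FR.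
have pi0 := @pi2_gt0 R.
have E m : cosco (im F) m = sinco (re F) m.
  have := FR m; rewrite Im_fourier// => /eqP.
  by rewrite mulf_eq0 invr_eq0 gt_eqF//= subr_eq0 => /eqP.
have := E (- n); rewrite coscoN sincoN// => E'.
have := E n => E''; split; lra.
Qed.

Definition cpairing N G H := pairing N (re G) (re H) + pairing N (im G) (im H).

(** With the cross terms gone, the term of the pairing at frequency n is half
    the sum of the products of Fourier coefficients at n and - n, up to a
    positive factor. *)
Lemma cpairing_le N J G H :
  L1 (re J) -> L1 (im J) -> L1 (re G) -> L1 (im G) -> L1 (re H) -> L1 (im H) ->
  real_fourier J -> real_fourier G -> real_fourier H ->
  (forall n, complex.Re (fourier J n) * complex.Re (fourier H n) <=
             complex.Re (fourier G n) * complex.Re (fourier H n)) ->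
  cpairing N J H <= cpairing N G H.
Proof.
move=> IJ1 IJ2 IG1 IG2 IH1 IH2 JR GR HR JG.
have pi0 := @pi2_gt0 R.
rewrite /cpairing !pairingE// -!mulrDr ler_wpM2l// -!big_split/=.
apply: ler_sum => kl _; move: (freq kl) => n.
have [-> ->] := real_fourier_cross n IJ1 IJ2 JR.
have [-> ->] := real_fourier_cross n IG1 IG2 GR.
have P m : (cosco (re J) m + sinco (im J) m) * (cosco (re H) m + sinco (im H) m) <=
   (cosco (re G) m + sinco (im G) m) * (cosco (re H) m + sinco (im H) m).
  have := JG m; rewrite !Re_fourier// mulrACA [X in _ <= X]mulrACA ler_pM2l//.
  by rewrite mulr_gt0// invr_gt0.
have := P n; have := P (- n); rewrite !coscoN !sincoN//.
lra.
Qed.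

(** F lies in L^((m+1)/m), expressed through the m-th root c of its modulus so
    that only integer powers appear. *)
Definition has_modulus F c m :=
  [/\ cmeasurable (circle R) F,
      cmfun c,
      forall t, 0 <= c t,
      forall t, cmod (F t) = c t ^+ m &
      L1 (fun t => c t ^+ m.+1)].

Lemma has_modulus_L1 F c m : has_modulus F c m -> L1 (re F) /\ L1 (im F).
Proof.
move=> [[m1 m2] mc c0 Fc Ic].
have L t : c t ^+ m <= c t ^+ m.+1 + 1.
  by have := young_crude m (c0 t) ler01; rewrite expr1n mulr1.
have I := L1D Ic (L1_cst 1).
by split; [apply: (L1_le m1 _ I)|apply: (L1_le m2 _ I)] => t _;
  apply: le_trans (L t); rewrite -Fc; [exact: Re_le_cmod|exact: Im_le_cmod].
Qed.

Lemma measurable_cmod F : cmeasurable (circle R) F ->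
  cmfun (fun t => cmod (F t)).
Proof.
move=> [m1 m2].
rewrite (_ : (fun t => _) = fun t => (re F t ^+ 2 + im F t ^+ 2) `^ 2^-1).
  apply: (measurableT_comp (measurable_powR _)).
  by apply: measurable_funD; exact: measurable_funX.
apply/funext => t; rewrite powR12_sqrt ?addr_ge0 ?sqr_ge0// -cmodE.
by rewrite sqrtr_sqr ger0_norm// cmod_ge0.
Qed.

Lemma in_Lp_L1 F m : in_Lp m.+1%:R F -> L1 (fun t => cmod (F t) ^+ m.+1).
Proof.
move=> [_ I]; rewrite [X in L1 X](_ : _ = fun t => cmod (F t) `^ m.+1%:R)//.
by apply/funext => t; rewrite powR_mulrn// cmod_ge0.
Qed.

Lemma cpairing_cvg G H c m : (0 < m)%N ->
  has_modulus G c m -> in_Lp m.+1%:R H ->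
  cpairing N G H @[N --> \oo] -->
  2 * pi * circle_int (fun t => complex.Re (G t * conjc (H t))).
Proof.
move=> m0 Gc HL; have [[m1 m2] mc c0 GcE Ic] := Gc.
have [G1 G2] := has_modulus_L1 Gc.
have [[h1 h2] _] := HL; have Ih := in_Lp_L1 HL.
have Ire : L1 (fun t => `|re H t| ^+ m.+1).
  apply: (L1_le _ _ Ih); first by apply: measurable_funX; exact: measurableT_comp.
  by move=> t It; rewrite normrX normr_id lerXn2r ?nnegrE ?cmod_ge0// Re_le_cmod.
have Iim : L1 (fun t => `|im H t| ^+ m.+1).
  apply: (L1_le _ _ Ih); first by apply: measurable_funX; exact: measurableT_comp.
  by move=> t It; rewrite normrX normr_id lerXn2r ?nnegrE ?cmod_ge0// Im_le_cmod.
have reG t : circle R t -> `|re G t| <= c t ^+ m by rewrite -GcE Re_le_cmod.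
have imG t : circle R t -> `|im G t| <= c t ^+ m by rewrite -GcE Im_le_cmod.
have prodL1 (a b : R -> R) :
    cmfun a ->
    cmfun b ->
    (forall t, circle R t -> `|a t| <= c t ^+ m) ->
    L1 (fun t => `|b t| ^+ m.+1) -> L1 (fun t => a t * b t).
  move=> ma mb ac Ib; apply: (L1_le (measurable_funM ma mb) _ (L1D Ic Ib)) => t It.
  rewrite normrM (le_trans _ (young_crude _ _ _))//.
  by rewrite ler_wpM2r// ac.
have -> : circle_int (fun t => complex.Re (G t * conjc (H t))) =
    circle_int (fun t => re G t * re H t) + circle_int (fun t => im G t * im H t).
  rewrite -circle_intD; [|exact: prodL1..].
  by apply: eq_circle_int => t _; exact: Re_mulconj.
rewrite mulrDr; apply: cvgD.
- exact: (pairing_cvg m0 mc m1 h1 c0 reG Ic Ire).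
- exact: (pairing_cvg m0 mc m2 h2 c0 imG Ic Iim).
Qed.

Lemma cmeasurableM F G : cmeasurable (circle R) F -> cmeasurable (circle R) G ->
  cmeasurable (circle R) (fun t => F t * G t).
Proof.
move=> [f1 f2] [g1 g2]; split.
  rewrite (_ : (fun t => _) = fun t => re F t * re G t - im F t * im G t).
    by apply: measurable_funB; exact: measurable_funM.
  by apply/funext => t; rewrite /re /im; case: (F t) (G t) => a b [].
rewrite (_ : (fun t => _) = fun t => re F t * im G t + im F t * re G t).
  by apply: measurable_funD; exact: measurable_funM.
by apply/funext => t; rewrite /re /im; case: (F t) (G t) => a b [].
Qed.

Lemma cmeasurableX F (n : nat) : cmeasurable (circle R) F ->
  cmeasurable (circle R) (fun t => F t ^+ n).
Proof.
move=> mF; elim: n => [|n IH].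
  by split; exact: measurable_cst.
rewrite (_ : (fun t => _) = fun t => F t * F t ^+ n); first exact: cmeasurableM.
by apply/funext => t; rewrite exprS.
Qed.

Lemma cmeasurable_conj F : cmeasurable (circle R) F ->
  cmeasurable (circle R) (fun t => conjc (F t)).
Proof.
move=> [m1 m2]; split.
  by rewrite (_ : (fun t => _) = re F)//; apply/funext => t; rewrite /re; case: (F t).
rewrite (_ : (fun t => _) = fun t => - im F t); first exact: measurableT_comp.
by apply/funext => t; rewrite /im; case: (F t).
Qed.

Lemma conj_product_modulus j H : (0 < j)%N -> in_Lp (2 * j)%:R H ->
  has_modulus (conj_product j H) (fun t => cmod (H t)) (2 * j).-1.
Proof.
move=> j0 HL; have [mH _] := HL.
split.
- apply: cmeasurableM; apply: cmeasurableX => //; exact: cmeasurable_conj.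
- exact: measurable_cmod.
- by move=> t; exact: cmod_ge0.
- by move=> t; exact: cmod_conj_product.
- by apply: in_Lp_L1; rewrite prednK// muln_gt0.
Qed.

Lemma in_Lp_modulus G m (p : R) : (0 < m)%N -> p = m.+1%:R / m%:R -> in_Lp p G ->
  has_modulus G (fun t => cmod (G t) `^ m%:R^-1) m.
Proof.
move=> m0 pE [mG IG].
have mn0 : m%:R != 0 :> R by rewrite pnatr_eq0 gtn_eqF.
split => //.
- by apply: (measurableT_comp (measurable_powR _)); exact: measurable_cmod.
- by move=> t; exact: powR_ge0.
- move=> t; rewrite -powR_mulrn ?powR_ge0// -powRrM mulVf// powRr1//.
  exact: cmod_ge0.
- rewrite [X in L1 X](_ : _ = fun t => cmod (G t) `^ p)//.
  by apply/funext => t; rewrite -powR_mulrn ?powR_ge0// -powRrM pE mulrC.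
Qed.

Lemma modulus_powR F c m (p : R) t : (0 < m)%N -> p = m.+1%:R / m%:R ->
  has_modulus F c m -> cmod (F t) `^ p = c t ^+ m.+1.
Proof.
move=> m0 pE [_ _ c0 Fc _].
rewrite Fc -!powR_mulrn// -powRrM pE mulrCA mulfV ?mulr1//.
by rewrite pnatr_eq0 gtn_eqF.
Qed.

Lemma modulus_in_Lp F c m (p : R) : (0 < m)%N -> p = m.+1%:R / m%:R ->
  has_modulus F c m -> in_Lp p F.
Proof.
move=> m0 pE Fc; have [mF _ _ _ Ic] := Fc; split => //.
rewrite [X in _.-integrable _ X](_ : _ = EFin \o (fun t => c t ^+ m.+1))//.
by apply/funext => t /=; rewrite (modulus_powR t m0 pE Fc).
Qed.

Lemma modulus_Lp_norm F c m (p : R) : (0 < m)%N -> p = m.+1%:R / m%:R ->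
  has_modulus F c m ->
  Lp_norm p F = ((2 * pi)^-1 * circle_int (fun t => c t ^+ m.+1)) `^ p^-1.
Proof.
move=> m0 pE Fc; rewrite /Lp_norm; congr ((_ * _) `^ _).
by apply: eq_circle_int => t _; exact: modulus_powR pE Fc.
Qed.

End fourier_pairing.

(** * Minimality and uniqueness *)

Section minimal_majorant.
Context {R : realType}.
Implicit Types (f F G H J K : R -> R[i]) (n : int).

Lemma majorant_real f F : majorant f F -> real_fourier F.
Proof.
by move=> fF n; have := fF n; rewrite lecE normc_def/= => /andP[/eqP].
Qed.

Lemma circle_int_eq0_ae (D : R -> R) : L1 D -> (forall t, circle R t -> 0 <= D t) ->
  circle_int D <= 0 -> {ae lebesgue_measure, forall t : R, circle R t -> D t = 0}.
Proof.
move=> ID D0 le0.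
have E : circle_int D = 0 by apply/eqP; rewrite eq_le le0 circle_int_ge0.
have : ae_eq lebesgue_measure (circle R) (EFin \o D) (cst 0%E).
  apply/ae_eq_integral_abs; first exact: measurable_circle.
    by apply/measurable_EFinP; exact: L1_measurable.
  transitivity (\int[lebesgue_measure]_(x in circle R) (D x)%:E)%E.
    apply: eq_integral.
    by move=> t; rewrite inE => It /=; rewrite ger0_norm// D0.
  rewrite -(fineK (integrable_fin_num measurable_circle ID)).
  by rewrite -[X in X%:E]/(circle_int D) E.
by apply: filterS => t /= H It; have := H It => -[].
Qed.

(** At each frequency either hat J = |hat f| <= hat G, or hat H = 0: the
    products with hat H >= 0 are ordered, hence so are the Fejer pairings and
    their limits. *)
Lemma conjugate_pairing_le j f H (p : R) G : (0 < j)%N ->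
  p = (2 * j)%:R / (2 * j).-1%:R -> p_conjugate j f H ->
  in_Lp p G -> majorant f G ->
  circle_int (fun t => complex.Re (conj_product j H t * conjc (H t))) <=
  circle_int (fun t => complex.Re (G t * conjc (H t))).
Proof.
move=> j0 pE [HL [H0 fJ Jf _]] GL fG.
have m0 := double_pred_gt0 j0.
have mE := double_predK j0.
have Jc := conj_product_modulus j0 HL.
have Gc : has_modulus G (fun t => cmod (G t) `^ (2 * j).-1%:R^-1) (2 * j).-1.
  by apply: in_Lp_modulus GL => //; rewrite mE.
have [J1 J2] := has_modulus_L1 Jc.
have [G1 G2] := has_modulus_L1 Gc.
have HL' : in_Lp (2 * j).-1.+1%:R H by rewrite mE.
have [H1 H2] : L1 (re H) /\ L1 (im H).
  (* H in L^(2j) is in particular in L^2, the case m = 1 *)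
  apply: (has_modulus_L1 (c := fun t => cmod (H t)) (m := 1)).
  have [mH _] := HL; split => //; first exact: measurable_cmod.
    by move=> t; exact: cmod_ge0.
  have I := L1D (L1_cst 1) (in_Lp_L1 HL').
  have mc := measurable_cmod mH.
  apply: (L1_le (measurable_funX _ mc) _ I) => t _.
  rewrite normrX ger0_norm ?cmod_ge0//=.
  have [h1|/ltW h1] := leP (cmod (H t)) 1.
    rewrite ler_wpDr ?exprn_ge0 ?cmod_ge0//.
    by rewrite expr_le1// cmod_ge0.
  by rewrite ler_wpDl// ler_weXn2l// ltnS.
have HR : real_fourier H by move=> n; have := H0 n; rewrite lecE/= => /andP[/eqP].
have JG n : complex.Re (fourier (conj_product j H) n) * complex.Re (fourier H n) <=
            complex.Re (fourier G n) * complex.Re (fourier H n).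
  have Hn : 0 <= complex.Re (fourier H n) by have := H0 n; rewrite lecE/= => /andP[].
  have := fJ n; rewrite le_eqVlt => /predU1P[E|/Jf ->]; last by rewrite !mulr0.
  rewrite ler_wpM2r//; have := fG n; rewrite E lecE => /andP[_].
  exact.
have pi0 := @pi2_gt0 R.
rewrite -(ler_pM2l pi0).
apply: (ler_cvg_to (cpairing_cvg m0 Jc HL') (cpairing_cvg m0 Gc HL')).
near=> N; apply: cpairing_le => //; exact: majorant_real fJ || exact: majorant_real fG.
Unshelve. all: by end_near. Qed.

(** The defect D in Young's inequality is nonnegative, and
    [conjugate_pairing_le] bounds its integral by a positive multiple of
    int |G|^p - int |J|^p. So the latter is nonnegative, and when it is zero D
    vanishes almost everywhere. *)
Lemma conjugate_minimal_majorant j f H (p : R) : (0 < j)%N ->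
  p = (2 * j)%:R / (2 * j).-1%:R -> p_conjugate j f H ->
  minimal_majorant p f (conj_product j H).
Proof.
move=> j0 pE HC; have [HL [H0 fJ _ _]] := HC.
have m0 := double_pred_gt0 j0.
have mE := double_predK j0.
have pE' : p = (2 * j).-1.+1%:R / (2 * j).-1%:R by rewrite mE.
have Jc := conj_product_modulus j0 HL.
have p0 : 0 < p by rewrite pE divr_gt0// ltr0n// muln_gt0.
have pi0 := @pi2_gt0 R.
have I0 (c : R -> R) : (forall t, 0 <= c t) ->
    0 <= (2 * pi)^-1 * circle_int (fun t => c t ^+ (2 * j).-1.+1).
  move=> c0; rewrite mulr_ge0 ?invr_ge0 ?(ltW pi0)// circle_int_ge0// => t _.
  by rewrite exprn_ge0.
pose h t := cmod (H t).
have h0 t : 0 <= h t by exact: cmod_ge0.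
have Ih : L1 (fun t => h t ^+ (2 * j).-1.+1) by case: Jc.
have JH : circle_int (fun t => complex.Re (conj_product j H t * conjc (H t))) =
          circle_int (fun t => h t ^+ (2 * j).-1.+1).
  by apply: eq_circle_int => t _; rewrite /conj_product conj_product_mulconj// mE.
pose cG G (t : R) := cmod (G t) `^ (2 * j).-1%:R^-1.
have defect G : in_Lp p G -> majorant f G ->
    let D t := (2 * j).-1%:R * cG G t ^+ (2 * j).-1.+1 + h t ^+ (2 * j).-1.+1 -
               (2 * j).-1.+1%:R * complex.Re (G t * conjc (H t)) in
    [/\ L1 D, forall t, 0 <= D t &
     circle_int D <= (2 * j).-1%:R * (circle_int (fun t => cG G t ^+ (2 * j).-1.+1) -
                                circle_int (fun t => h t ^+ (2 * j).-1.+1))].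
  move=> GL fG D.
  have [[g1 g2] mc c0 Gc Ic] := in_Lp_modulus m0 pE' GL.
  have IR : L1 (fun t => complex.Re (G t * conjc (H t))).
    have [mG _ _ _ _] := in_Lp_modulus m0 pE' GL; have [mH _] := HL.
    have [mR _] := cmeasurableM mG (cmeasurable_conj mH).
    apply: (L1_le mR _ (L1D Ic Ih)) => t It.
    apply: le_trans (Re_le_cmod _) _; rewrite cmodM cmod_conj [X in X * _]Gc.
    exact: (young_crude _ (c0 t) (h0 t)).
  have I1 := L1Z (2 * j).-1%:R Ic.
  have I3 := L1Z (2 * j).-1.+1%:R IR.
  split.
  - by apply: L1B => //; exact: L1D.
  - by move=> t; rewrite subr_ge0; exact: (duality_le (H t) (c0 t) (Gc t)).
  rewrite /D circle_intB//; last exact: L1D.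
  rewrite circle_intD// !circle_intZ//.
  have := conjugate_pairing_le j0 pE HC GL fG; rewrite JH.
  move=> le1.
  have : (2 * j).-1.+1%:R * circle_int (fun t => h t ^+ (2 * j).-1.+1) <=
    (2 * j).-1.+1%:R * circle_int (fun t => complex.Re (G t * conjc (H t))).
    by rewrite ler_wpM2l.
  by rewrite -natr1; lra.
split.
- exact: modulus_in_Lp pE' Jc.
- exact: fJ.
- move=> G GL fG; have [ID D0 Dle] := defect G GL fG.
  have Gc := in_Lp_modulus m0 pE' GL.
  rewrite (modulus_Lp_norm m0 pE' Jc) (modulus_Lp_norm m0 pE' Gc).
  apply: ge0_ler_powR; rewrite ?nnegrE ?invr_ge0 ?(ltW p0)//.
  - exact: (I0 _ h0).
  - by have [_ _ c0 _ _] := Gc; exact: (I0 _ c0).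
  rewrite ler_wpM2l ?invr_ge0 ?(ltW pi0)// -subr_ge0.
  rewrite -(pmulr_rge0 _ (_ : 0 < (2 * j).-1%:R)) ?ltr0n//.
  by apply: le_trans Dle; exact: circle_int_ge0.
- move=> G GL fG; have [ID D0 Dle] := defect G GL fG.
  have Gc := in_Lp_modulus m0 pE' GL.
  rewrite (modulus_Lp_norm m0 pE' Jc) (modulus_Lp_norm m0 pE' Gc).
  move=> /powR_injective; rewrite invr_gt0 => /(_ p0); rewrite !nnegrE.
  have [_ _ c0 GE _] := Gc.
  move=> /(_ (I0 _ c0) (I0 _ h0)) /mulfI.
  rewrite invr_eq0 gt_eqF// => /(_ isT) E.
  have := circle_int_eq0_ae ID (fun t _ => D0 t); rewrite E subrr mulr0 in Dle *.
  move=> /(_ Dle); rewrite /ae_eq_circle.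
  apply: (@filterS _ _ (ae_filter_ringOfSetsType lebesgue_measure)) => t Dt It.
  move: (Dt It) => /eqP; rewrite subr_eq0 mE => /eqP/esym DE.
  exact: (duality_eq j0 (c0 t) (GE t) DE).
Qed.

Lemma p_conjugate_unique j f H K (p : R) : (0 < j)%N ->
  p = (2 * j)%:R / (2 * j).-1%:R -> p_conjugate j f H -> p_conjugate j f K ->
  ae_eq_circle K H.
Proof.
move=> j0 pE HC KC.
have [JH1 fH leH eqH] := conjugate_minimal_majorant j0 pE HC.
have [JK1 fK leK _] := conjugate_minimal_majorant j0 pE KC.
have norm_eq : Lp_norm p (conj_product j K) = Lp_norm p (conj_product j H).
  by apply/le_anti/andP; split; [exact: leK JH1 fH|exact: leH JK1 fK].
have := eqH _ JK1 fK norm_eq; rewrite /ae_eq_circle.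
apply: (@filterS _ _ (ae_filter_ringOfSetsType lebesgue_measure)) => t JKH It.
exact: conj_product_inj j0 (JKH It).
Qed.

End minimal_majorant.

Theorem corollary1p5 (R : realType) (j : nat) (p : R) (f H : R -> R[i])
  (hj : (1 < j)%N) (hp : p = (2 * j)%:R / (2 * j - 1)%:R)
  (hf : in_Lp p f) (hH : p_conjugate j f H) :
  minimal_majorant p f (conj_product j H) /\
  (forall K : R -> R[i], p_conjugate j f K -> ae_eq_circle K H).
Proof.
have j0 : (0 < j)%N by exact: ltn_trans hj.
rewrite subn1 in hp; split; first exact: conjugate_minimal_majorant.
by move=> K hK; exact: (p_conjugate_unique j0 hp hH hK).
Qed.
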